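(* The $r\times r$ minors of an $n\times n$ symmetric matrix of indeterminates do not form a tropical basis when $4<r<n$, or when $r=4$ and $n>12$.
   Context: Let $\tilde K$ be the field of Hahn series $\sum_{\alpha\in A}c_\alpha t^\alpha$ ($A\subset\mathbb R$ well-ordered, $c_\alpha\in\mathbb C$); for nonzero $a\in\tilde K$, $\deg(a)$ is the smallest exponent with nonzero coefficient. A symmetric lift of a real symmetric matrix $A$ is a symmetric matrix $\tilde A$ over $\tilde K$ with all entries nonzero and $\deg(\tilde a_{i,j})=A_{i,j}$. For an $r\times r$ submatrix of $A$ with row index set $I$ and column index set $J$, each bijection $\rho:I\to J$ gives a monomial $\prod_{i\in I}X_{i,\rho(i)}$ in commuting variables subject to $X_{i,j}=X_{j,i}$, with value $\sum_{i\in I}A_{i,\rho(i)}$; the submatrix is symmetrically tropically singular if the minimum value is attained by at least two distinct monomials. The $r\times r$ minors of an $n\times n$ symmetric matrix of indeterminates form a tropical basis if for every real symmetric $n\times n$ matrix $A$: every $r\times r$ submatrix of $A$ is symmetrically tropically singular if and only if $A$ has a symmetric lift of rank at most $r-1$ (equivalently, the tropical prevariety of the tropicalized minors equals the tropicalization of the variety they define). *)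

(* Defs.v *)
From HB Require Import structures.
From mathcomp Require Import all_boot all_order all_algebra all_fingroup.
From mathcomp Require Import all_classical all_reals.
From mathcomp Require Import complex.
Set Implicit Arguments. Unset Strict Implicit. Unset Printing Implicit Defensive.
Import Order.TTheory GRing.Theory Num.Theory.
Local Open Scope ring_scope.
Local Open Scope classical_set_scope.

Section Hahn.
Variable R : realType.

(** Raw formal series sum_{alpha in R} c_alpha t^alpha, coefficients in C = R[i]. *)
Definition series := R -> R[i].

Definition supp (a : series) : set R := [set x | a x != 0].

Definition is_hahn (a : series) : Prop :=
  forall S : set R, S `<=` supp a -> S !=set0 ->
    exists2 m, S m & forall x, S x -> m <= x.

Definition hzero : series := fun _ => 0.
Definition hone : series := fun x => if x == 0 then 1 else 0.
Definition hadd (a b : series) : series := fun x => a x + b x.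
Definition hscale (c : R[i]) (a : series) : series := fun x => c * a x.
(** Cauchy product: coefficient of t^g is sum over alpha of a_alpha b_{g-alpha}
    (a finitely supported sum when a, b are Hahn series). *)
Definition hmul (a b : series) : series :=
  fun g => \sum_(al \in [set: R]) (a al * b (g - al)).

Definition hdeg_is (a : series) (d : R) : Prop :=
  a d != 0 /\ forall x, x < d -> a x = 0.

Definition sym_lift (n : nat) (A : 'M[R]_n) (L : 'I_n -> 'I_n -> series) : Prop :=
  (forall i j, L i j = L j i) /\
  (forall i j, is_hahn (L i j)) /\
  (forall i j, L i j <> hzero) /\
  (forall i j, hdeg_is (L i j) (A i j)).

Definition hminor (n r : nat) (L : 'I_n -> 'I_n -> series)
    (f g : 'I_r -> 'I_n) : series :=
  \big[hadd/hzero]_(s : 'S_r)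
     hscale ((-1) ^+ s) (\big[hmul/hone]_(i < r) L (f i) (g (s i))).

Definition rank_le_pred (n r : nat) (L : 'I_n -> 'I_n -> series) : Prop :=
  forall f g : 'I_r -> 'I_n, injective f -> injective g -> hminor L f g = hzero.

Definition is_bij (n : nat) (I J : {set 'I_n}) (rho : 'I_n -> 'I_n) : Prop :=
  (forall k, k \in I -> rho k \in J) /\
  {in I &, injective rho}.

(** the monomial prod_{i in I} X_{i, rho i} with X_{ij} = X_{ji}:
    its exponent of X_{ij} (as an unordered pair) *)
Definition monomial (n : nat) (I : {set 'I_n}) (rho : 'I_n -> 'I_n)
    : {ffun 'I_n * 'I_n -> nat} :=
  [ffun p => #|[set k in I | ((k, rho k) == p) || ((rho k, k) == p)]|].

Definition mono_val (n : nat) (A : 'M[R]_n) (I : {set 'I_n}) (rho : 'I_n -> 'I_n) : R :=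
  \sum_(k in I) A k (rho k).

Definition sym_trop_singular (n : nat) (A : 'M[R]_n) (I J : {set 'I_n}) : Prop :=
  exists rho1 rho2, [/\ is_bij I J rho1, is_bij I J rho2,
    monomial I rho1 != monomial I rho2,
    mono_val A I rho1 = mono_val A I rho2 &
    forall rho, is_bij I J rho -> mono_val A I rho1 <= mono_val A I rho].

Definition minors_tropical_basis (n r : nat) : Prop :=
  forall A : 'M[R]_n, A^T = A ->
    ((forall I J : {set 'I_n}, #|I| = r -> #|J| = r -> sym_trop_singular A I J)
     <-> exists L, sym_lift A L /\ rank_le_pred r L).

End Hahn.

(* Main.v *)
Require Import Defs.
From HB Require Import structures.
From mathcomp Require Import all_boot all_order all_algebra all_fingroup.
From mathcomp Require Import all_classical all_reals.
From mathcomp Require Import complex.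
From mathcomp Require Import ring lra.
Set Implicit Arguments. Unset Strict Implicit. Unset Printing Implicit Defensive.
Import Order.TTheory GRing.Theory Num.Theory.
Local Open Scope ring_scope.
Local Open Scope classical_set_scope.

(** Let [A] be a symmetric matrix all of whose [r]-minors are symmetrically
    tropically singular and which has no symmetric lift of rank less than [r]
    (a gap of size [m] for [r]).  Repeating rows and columns of [A] preserves
    this: two equal rows can exchange their images in an optimal bijection, which
    always changes the symmetric monomial.  Adding one index with diagonal entry
    0 and very large off-diagonal entries turns a gap for [(m, r)] into one for
    [(m + 1, r + 1)]: a low rank lift condenses, by Chio's formula, to a lift of
    [A].  So two examples suffice.

    For [(m, r) = (6, 5)], a symmetric arrangement of Shitov's 6 x 6 matrix: the
    4-minors [T k l] bordering a fixed 3-minor form, by Sylvester's identity, a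
    3 x 3 matrix of rank one, whence [T12 T23 T31 = T13 T21 T32]; but the
    off-diagonal [T k l] are tropically nonsingular, so their degrees are known,
    and the two products have degrees 6 and 7.

    For [(m, r) = (9, 4)], nine points of the projective plane over F_3 with its
    orthogonal polarity: the residues at [t = 0] of a rank 3 lift would realise
    this configuration over a field of characteristic 0, and it forces 3 = 0. *)

(** * Well-ordered sets of reals *)

Section WellOrderedSets.
Variable R : realType.
Implicit Types A B S : set R.

Definition well_ordered A := forall S, S `<=` A -> S !=set0 ->
  exists2 m, S m & forall x, S x -> m <= x.

Definition sumset A B : set R := [set z | exists x y, [/\ A x, B y & z = x + y]].

Lemma well_ordered_sub A B : A `<=` B -> well_ordered B -> well_ordered A.
Proof. by move=> AB wB S SA; apply: wB => x /SA /AB. Qed.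

Lemma well_ordered_setU A B : well_ordered A -> well_ordered B -> well_ordered (A `|` B).
Proof.
move=> wA wB S SAB [s Ss].
have [SA0|/set0P SA0] := eqVneq (S `&` A) set0.
  apply: wB; last by exists s.
  move=> x Sx; case: (SAB _ Sx) => // Ax.
  by have : (S `&` A) x by []; rewrite SA0.
have [SB0|/set0P SB0] := eqVneq (S `&` B) set0.
  apply: wA; last by exists s.
  move=> x Sx; case: (SAB _ Sx) => // Bx.
  by have : (S `&` B) x by []; rewrite SB0.
have [m [Sm _] mP] := wA _ (@subIsetr _ _ _) SA0.
have [k [Sk _] kP] := wB _ (@subIsetr _ _ _) SB0.
exists (Num.min m k); first by case: (leP m k).
by move=> x Sx; rewrite ge_min; case: (SAB _ Sx) => ?; apply/orP;
  [left; apply: mP | right; apply: kP].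
Qed.

Lemma well_ordered_set1 (a : R) : well_ordered [set a].
Proof.
by move=> S Sa [s Ss]; exists s => // x /Sa ->; rewrite (Sa _ Ss).
Qed.

(* Among the decompositions a + b of elements of S such that every smaller
   element of S decomposes only with a larger first summand, one with b minimal
   gives the minimum of S. *)
Lemma well_ordered_sumset A B : well_ordered A -> well_ordered B -> well_ordered (sumset A B).
Proof.
move=> wA wB S SAB S0.
pose dec T a := exists b, [/\ A a, B b & T (a + b)].
have decP T : T `<=` S -> T !=set0 ->
    exists2 a, dec T a & forall a', dec T a' -> a <= a'.
  move=> TS [t Tt]; apply: wA; first by move=> a [b []].
  by have [a [b [Aa Bb tab]]] := SAB _ (TS _ Tt); exists a, b; rewrite -tab.
pose Q b := exists a, [/\ A a, B b, S (a + b) &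
  forall a' b', A a' -> B b' -> S (a' + b') -> a' + b' < a + b -> a <= a'].
have [b [a [Aa Bb Sab abP]] bmin] : exists2 b, Q b & forall b', Q b' -> b <= b'.
  apply: wB; first by move=> b [a []].
  have [a [b [Aa Bb Sab]] amin] := decP S (fun _ h => h) S0.
  by exists b, a; split=> // a' b' Aa' Bb' Sab' _; apply: amin; exists b'.
exists (a + b) => // x Sx; rewrite leNgt; apply/negP => xab.
have [a1 [b1 [Aa1 Bb1 [Sab1 lt1]]] a1min] :=
  decP [set y | S y /\ y < a + b] (fun _ h => proj1 h)
    (ex_intro _ x (conj Sx xab)).
have : b <= b1.
  apply: bmin; exists a1; split=> // a' b' Aa' Bb' Sab' lt'.
  by apply: a1min; exists b'; split=> //; split=> //; apply: lt_trans lt1.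
by have := abP _ _ Aa1 Bb1 Sab1 lt1; lra.
Qed.

(* Every nonempty subset has both a minimum (in A) and a maximum (from B),
   which forces finiteness. *)
Lemma well_ordered_convolution_finite A B (g : R) : well_ordered A -> well_ordered B ->
  finite_set [set x | A x /\ B (g - x)].
Proof.
move=> wA wB; set E := [set x | _]; apply: contrapT => infE.
have Emin S : S `<=` E -> S !=set0 -> exists2 m, S m & forall x, S x -> m <= x.
  by move=> SE; apply: wA => x /SE[].
have Emax S : S `<=` E -> S !=set0 -> exists2 m, S m & forall x, S x -> x <= m.
  move=> SE [s Ss].
  have [y /SE[_]||m Sm mP] := wB [set y | S (g - y)].
  - by rewrite subKr.
  - by exists (g - s); rewrite /= subKr.
  exists (g - m) => // x Sx; have := mP (g - x).
  by rewrite /= subKr => /(_ Sx); lra.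
pose below x := E `&` [set y | y <= x].
(* Descent: the minimum [m] of [F] still has infinitely many points of [E] strictly below it, and
   the largest of these again belongs to [F]. *)
pose F := [set x | E x /\ infinite_set (below x)].
have F0 : F !=set0.
  have E0 : E !=set0.
    apply/set0P/negP => /eqP E0; apply: infE; rewrite E0; exact: finite_set0.
  have [m Em mP] := Emax E (fun _ h => h) E0.
  exists m; split=> //; suff -> : below m = E by [].
  by apply/seteqP; split=> x => [[]|Ex] //; split=> //; apply: mP.
have [m [Em infm] mP] := Emin F (fun _ h => proj1 h) F0.
pose low := E `&` [set y | y < m].
have inflow : infinite_set low.
  move=> flow; apply: infm; apply: (@sub_finite_set _ _ (low `|` [set m])).
    move=> y [Ey]; rewrite /= le_eqVlt => /orP[/eqP ->|ym]; first by right.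
    by left.
  by rewrite finite_setU; split=> //; apply: finite_set1.
have low0 : low !=set0.
  by apply/set0P/negP => /eqP l0; apply: inflow; rewrite l0; exact: finite_set0.
have [k [Ek /= km] kP] := Emax low (fun _ h => proj1 h) low0.
have Fk : F k.
  split=> // fk; apply: inflow; apply: sub_finite_set fk => y yl.
  by split; [case: yl | apply: kP].
by have := mP _ Fk; rewrite leNgt km.
Qed.

End WellOrderedSets.

(** * Hahn series as a commutative ring; degrees *)

Section HahnRing.
Variable R : realType.
Implicit Types (a b c : series R) (g x y : R).

Lemma suppP a x : ~ supp a x -> a x = 0.
Proof. by move=> h; apply/eqP/negPn/negP. Qed.

Lemma hahn_conv_finite a b g : is_hahn a -> is_hahn b ->
  finite_set [set x | supp a x /\ supp b (g - x)].
Proof. exact: well_ordered_convolution_finite. Qed.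

(** Products with different supports can thus be summed over one common index set, as distributivity
    and associativity require. *)
Lemma hmul_widen a b g (X : set R) :
  [set x | supp a x /\ supp b (g - x)] `<=` X ->
  hmul a b g = \sum_(x \in X) (a x * b (g - x)).
Proof.
move=> sX; apply/esym/fsbig_widen => // x [_ nXx] /=.
have [->|ax] := eqVneq (a x) 0; first by rewrite mul0r.
have [->|bx] := eqVneq (b (g - x)) 0; first by rewrite mulr0.
by case: nXx; apply: sX.
Qed.

Lemma supp_hmul a b : supp (hmul a b) `<=` sumset (supp a) (supp b).
Proof.
move=> g; rewrite /supp /= => /(@fsbigN1 _ _ _ _ _ _ (fun g x => a x * b (g - x)) g).
move=> [x _ nz]; exists x, (g - x); split; last by rewrite addrC subrK.
- by apply: contra_neq nz => ->; rewrite mul0r.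
- by apply: contra_neq nz => ->; rewrite mulr0.
Qed.

Lemma is_hahn_mul a b : is_hahn a -> is_hahn b -> is_hahn (hmul a b).
Proof. by move=> ha hb; apply: well_ordered_sub (@supp_hmul _ _) (well_ordered_sumset ha hb). Qed.

Lemma is_hahn_add a b : is_hahn a -> is_hahn b -> is_hahn (hadd a b).
Proof.
move=> ha hb; apply: well_ordered_sub (well_ordered_setU ha hb) => x; rewrite /supp /hadd /= => nz.
have [ax|] := eqVneq (a x) 0; last by left.
by right; rewrite ax add0r in nz.
Qed.

Lemma is_hahn0 : is_hahn (@hzero R).
Proof. by move=> S S0 [s /S0]; rewrite /supp /= eqxx. Qed.

Lemma is_hahn1 : is_hahn (@hone R).
Proof.
apply: (@well_ordered_sub _ _ [set 0]); last exact: well_ordered_set1.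
by move=> x; rewrite /supp /hone /=; case: (eqVneq x 0) => [->|] //; rewrite eqxx.
Qed.

Lemma is_hahn_scale (k : R[i]) a : is_hahn a -> is_hahn (hscale k a).
Proof.
move=> ha; apply: well_ordered_sub ha => x; rewrite /supp /hscale /=.
by apply: contra_neq => ->; rewrite mulr0.
Qed.

Lemma hmulC a b : hmul a b = hmul b a.
Proof.
apply/funext => g; rewrite /hmul (@reindex_fsbigT _ _ _ _ _ (fun x => g - x)).
  by apply: eq_fsbigr => x _; rewrite subKr mulrC.
by exists (fun x => g - x) => x; rewrite subKr.
Qed.

Lemma hmulDl a b c : is_hahn a -> is_hahn b -> is_hahn c ->
  hmul (hadd a b) c = hadd (hmul a c) (hmul b c).
Proof.
move=> ha hb hc; apply/funext => g; rewrite /hadd.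
pose X := [set x | supp a x /\ supp c (g - x)] `|`
          [set x | supp b x /\ supp c (g - x)].
have fX : finite_set X by rewrite finite_setU; split; apply: hahn_conv_finite.
rewrite !(@hmul_widen _ _ _ X).
- by rewrite -fsbig_split //=; apply: eq_fsbigr => x _; rewrite mulrDl.
- by move=> x; right.
- by move=> x; left.
move=> x [abx cx]; have [ax|] := eqVneq (a x) 0; last by left.
by right; split=> //; move: abx; rewrite /supp /= ax add0r.
Qed.

Lemma hmul1 a : hmul (@hone R) a = a.
Proof.
apply/funext => g; rewrite (@hmul_widen _ _ _ [set 0]).
  by rewrite fsbig_set1 /hone eqxx mul1r subr0.
by move=> x [] /=; rewrite /supp /hone /=; case: (eqVneq x 0) => [->|] //; rewrite eqxx.
Qed.

Lemma hmulA a b c : is_hahn a -> is_hahn b -> is_hahn c ->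
  hmul a (hmul b c) = hmul (hmul a b) c.
Proof.
move=> ha hb hc; apply/funext => g.
pose X := [set x | sumset (supp a) (supp b) x /\ supp c (g - x)].
pose Y := [set y | supp a y /\ sumset (supp b) (supp c) (g - y)].
have fX : finite_set X.
  by apply: well_ordered_convolution_finite => //; apply: well_ordered_sumset.
have fY : finite_set Y.
  by apply: well_ordered_convolution_finite => //; apply: well_ordered_sumset.
rewrite (@hmul_widen a _ _ Y); last first.
  by move=> y [ay bcy]; split=> //; apply: supp_hmul.
rewrite (@hmul_widen _ c _ X); last first.
  by move=> x [abx cx]; split=> //; apply: supp_hmul.
(* Both sides become one double sum over finite sets: [y] is the exponent taken from [a], and [x]
   the total exponent taken from [a] and [b]. *)
transitivity (\sum_(y \in Y) \sum_(x \in X) (a y * b (x - y) * c (g - x))).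
  apply: eq_fsbigr => y /[!inE] -[ay _].
  rewrite /hmul (@reindex_fsbigT _ _ _ _ _ (fun x => x - y)); last first.
    by exists (fun x => x + y) => x; rewrite ?subrK ?addrK.
  rewrite mulr_fsumr; apply/esym.
  transitivity (\sum_(x \in [set: R]) a y * b (x - y) * c (g - x)).
    apply: fsbig_widen => // x [_ nX] /=.
    have [->|cx] := eqVneq (c (g - x)) 0; first by rewrite mulr0.
    have [->|bx] := eqVneq (b (x - y)) 0; first by rewrite mulr0 mul0r.
    case: nX; split=> //; exists y, (x - y); split=> //.
    by rewrite addrC subrK.
  by apply: eq_fsbigr => x _; rewrite mulrA; congr (_ * c _); ring.
rewrite exchange_fsbig //; apply: eq_fsbigr => x /[!inE] -[_ cx].
rewrite /hmul mulr_fsuml; apply: fsbig_widen => // y [_ nY] /=.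
have [->|ay] := eqVneq (a y) 0; first by rewrite !mul0r.
have [->|bx] := eqVneq (b (x - y)) 0; first by rewrite mulr0 mul0r.
case: nY; split=> //; exists (x - y), (g - x); split=> //; ring.
Qed.

(** Bundling makes determinants over a commutative ring available. Cancelling elements that have a
    degree ([hdeg_lreg]) takes the place of division. *)
Record hahn := Hahn { hval : series R; hvalP : is_hahn hval }.
Arguments hvalP : clear implicits.
Arguments Hahn : clear implicits.

HB.instance Definition _ := gen_eqMixin hahn.
HB.instance Definition _ := gen_choiceMixin hahn.

Lemma hval_inj : injective hval.
Proof.
move=> [a pa] [b pb] /= eab; case: b / eab pb => pb.
by congr Hahn; apply: Prop_irrelevance.
Qed.

Definition hahn_add (u v : hahn) := Hahn _ (is_hahn_add (hvalP u) (hvalP v)).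
Definition hahn_mul (u v : hahn) := Hahn _ (is_hahn_mul (hvalP u) (hvalP v)).
Definition hahn_opp (u : hahn) := Hahn _ (@is_hahn_scale (-1) _ (hvalP u)).

Fact hahn_addA : associative hahn_add.
Proof. by move=> u v w; apply/hval_inj/funext => x; apply: addrA. Qed.
Fact hahn_addC : commutative hahn_add.
Proof. by move=> u v; apply/hval_inj/funext => x; apply: addrC. Qed.
Fact hahn_add0 : left_id (Hahn _ is_hahn0) hahn_add.
Proof. by move=> u; apply/hval_inj/funext => x; apply: add0r. Qed.
Fact hahn_addN : left_inverse (Hahn _ is_hahn0) hahn_opp hahn_add.
Proof.
by move=> u; apply/hval_inj/funext => x; rewrite /= /hadd /hscale mulN1r addNr.
Qed.

HB.instance Definition _ :=
  GRing.isZmodule.Build hahn hahn_addA hahn_addC hahn_add0 hahn_addN.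

Fact hahn_mulA : associative hahn_mul.
Proof. by move=> u v w; apply/hval_inj/hmulA; apply: hvalP. Qed.
Fact hahn_mulC : commutative hahn_mul.
Proof. by move=> u v; apply/hval_inj/hmulC. Qed.
Fact hahn_mul1 : left_id (Hahn _ is_hahn1) hahn_mul.
Proof. by move=> u; apply/hval_inj/hmul1. Qed.
Fact hahn_mulDl : left_distributive hahn_mul +%R.
Proof. by move=> u v w; apply/hval_inj/hmulDl; apply: hvalP. Qed.
Fact hahn_oner_neq0 : Hahn _ is_hahn1 != 0.
Proof.
apply/eqP => /(congr1 (fun u => hval u 0)); rewrite /= /hone eqxx => /eqP.
by rewrite oner_eq0.
Qed.

HB.instance Definition _ := GRing.Zmodule_isComNzRing.Build hahn
  hahn_mulA hahn_mulC hahn_mul1 hahn_mulDl hahn_oner_neq0.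

Lemma hval0 : hval 0 = @hzero R. Proof. by []. Qed.
Lemma hval1 : hval 1 = @hone R. Proof. by []. Qed.
Lemma hvalD u v : hval (u + v) = hadd (hval u) (hval v). Proof. by []. Qed.
Lemma hvalM u v : hval (u * v) = hmul (hval u) (hval v). Proof. by []. Qed.

Lemma hval_sign (s : bool) u : hval ((-1) ^+ s * u) = hscale ((-1) ^+ s) (hval u).
Proof.
apply/funext => x; case: s; last by rewrite !expr0 mul1r /hscale mul1r.
by rewrite !expr1 mulN1r.
Qed.

(** The bound deg(u) >= d in a form that the zero series satisfies too, hence stable under sums. *)
Definition hge (u : hahn) (d : R) := forall x, x < d -> hval u x = 0.

Lemma hge_le u d e : d <= e -> hge u e -> hge u d.
Proof. by move=> de ue x xd; apply: ue; apply: lt_le_trans de. Qed.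

Lemma hgeD u v d : hge u d -> hge v d -> hge (u + v) d.
Proof. by move=> ud vd x xd; rewrite hvalD /hadd ud ?vd ?addr0. Qed.

Lemma hgeN u d : hge u d -> hge (- u) d.
Proof. by move=> ud x xd; rewrite /= /hscale ud ?mulr0. Qed.

Lemma hge_sign (s : bool) u d : hge u d -> hge ((-1) ^+ s * u) d.
Proof. by move=> ud x xd; rewrite hval_sign /hscale ud ?mulr0. Qed.

Lemma hval_sum (I : finType) (F : I -> hahn) x :
  hval (\sum_i F i) x = \sum_i hval (F i) x.
Proof. by apply: (big_morph (fun u => hval u x)). Qed.

(** No exponent below d + e splits into exponents of the two supports, and d + e can only split as d
    and e. *)
Lemma hgeM u v d e : hge u d -> hge v e ->
  hge (u * v) (d + e) /\ hval (u * v) (d + e) = hval u d * hval v e.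
Proof.
move=> ud ve; split.
  move=> x xde; rewrite hvalM; apply: suppP => /supp_hmul[y [z [uy vz xyz]]].
  have dy : d <= y by rewrite leNgt; apply/negP => /ud uy0; rewrite /supp /= uy0 eqxx in uy.
  have ez : e <= z by rewrite leNgt; apply/negP => /ve vz0; rewrite /supp /= vz0 eqxx in vz.
  by lra.
rewrite hvalM (@hmul_widen _ _ _ [set d]).
  by rewrite fsbig_set1; congr (_ * hval v _); ring.
move=> y [uy vz] /=.
have dy : d <= y by rewrite leNgt; apply/negP => /ud uy0; rewrite /supp /= uy0 eqxx in uy.
have : e <= d + e - y by rewrite leNgt; apply/negP => /ve vz0; rewrite /supp /= vz0 eqxx in vz.
by lra.
Qed.

Lemma hge_prod n (F : 'I_n -> hahn) (d : 'I_n -> R) :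
  (forall i, hge (F i) (d i)) ->
  hge (\prod_i F i) (\sum_i d i) /\
  hval (\prod_i F i) (\sum_i d i) = \prod_i hval (F i) (d i).
Proof.
elim: n F d => [|n IHn] F d Fd.
  rewrite !big_ord0; split; last by rewrite hval1 /hone eqxx.
  by move=> x x0; rewrite hval1 /hone lt_eqF.
rewrite !big_ord_recl /=.
have [ge eq] := IHn (fun i => F (lift ord0 i)) (fun i => d (lift ord0 i)) (fun i => Fd _).
have [ge' eq'] := hgeM (Fd ord0) ge; split; first exact: ge'.
by rewrite -eq; exact: eq'.
Qed.

Lemma hdegM u v d e : hdeg_is (hval u) d -> hdeg_is (hval v) e ->
  hdeg_is (hval (u * v)) (d + e).
Proof.
move=> [ud gu] [ve gv]; have [ge eq] := hgeM gu gv.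
by split=> //; rewrite eq mulf_neq0.
Qed.

Lemma hdeg_inj a d e : hdeg_is a d -> hdeg_is a e -> d = e.
Proof.
move=> [ad gd] [ae ge]; case: (ltgtP d e) => // [de|ed].
- by rewrite ge ?eqxx in ad.
- by rewrite gd ?eqxx in ae.
Qed.

Lemma hahn_min u : u != 0 -> exists d, hdeg_is (hval u) d.
Proof.
move=> u0; have [|d ud dP] := hvalP u (supp (hval u)) (fun _ h => h).
  apply: contrapT => nz; move/eqP: u0; apply; apply/hval_inj/funext => x.
  by apply: suppP => ux; apply: nz; exists x.
exists d; split=> // x xd; apply: suppP => /dP.
by rewrite leNgt xd.
Qed.

(** If v and w differ, then v - w has a degree; degrees add, so u * (v - w) keeps a nonzero leading
    coefficient. *)
Lemma hdeg_lreg u d : hdeg_is (hval u) d -> GRing.lreg u.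
Proof.
move=> ud v w /eqP; rewrite -subr_eq0 -mulrBr => /eqP uvw.
apply/eqP; rewrite -subr_eq0; apply/negP => /negP /hahn_min[e ve].
by have [] := hdegM ud ve; rewrite uvw hval0 /hzero eqxx.
Qed.

Lemma hminorE n r (L : 'I_n -> 'I_n -> hahn) (f g : 'I_r -> 'I_n) :
  hminor (fun i j => hval (L i j)) f g =
  hval (\det (\matrix_(i, j) L (f i) (g j))).
Proof.
rewrite /hminor /determinant (big_morph hval hvalD hval0).
apply: eq_bigr => s _; rewrite hval_sign (big_morph hval hvalM hval1).
by congr hscale; apply: eq_bigr => i _; rewrite mxE.
Qed.

End HahnRing.
Arguments hvalP {R} h.
Arguments Hahn {R} hval hvalP.

(** * Schur complements, Sylvester's identity, leading terms of determinants *)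

Section Determinants.

Lemma det_mx22 (K : comNzRingType) (M : 'M[K]_2) :
  \det M = M 0 0 * M 1 1 - M 0 1 * M 1 0.
Proof.
rewrite (expand_det_row _ 0) !big_ord_recl big_ord0 addr0 /cofactor !det_mx11.
rewrite !mxE /= addn0 expr0 mul1r addn1 expr1 mulN1r mulrN.
have -> : lift ord0 0 = 1 :> 'I_2 by apply/val_inj.
by have -> : lift 1 0 = 0 :> 'I_2 by apply/val_inj.
Qed.

(* Schur complement without inverting the pivot block P. *)
Lemma det_schur (K : comNzRingType) m q (P : 'M[K]_m) (X : 'M_(m, q))
    (Y : 'M_(q, m)) (D : 'M_q) : GRing.lreg (\det P) ->
  \det (block_mx P X Y D) * \det P ^+ q =
  \det P * \det (\det P *: D - Y *m \adj P *m X).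
Proof.
move=> regP; set S := _ - _; set M := block_mx _ _ _ _.
(* Column operations with [\adj P] in the role of the inverse of [P]: the second factor is block
   triangular and clears [X]. *)
have eM : M *m block_mx (\adj P) (- (\adj P *m X)) 0 (\det P)%:M =
    block_mx (\det P)%:M 0 (Y *m \adj P) S.
  rewrite /M mulmx_block !mulmx0 !addr0 mul_mx_adj !mulmxN !mulmxA mul_mx_adj.
  rewrite !mul_mx_scalar mul_scalar_mx addNr; congr block_mx.
  by rewrite addrC.
(* The extra factor [\det P] turns [\det (\adj P)] into a power of [\det P], which can be
   cancelled. *)
have := congr1 (fun N => \det N * \det P) eM.
rewrite det_mulmx det_ublock det_lblock !det_scalar => e.
have dadj : \det P * \det (\adj P) = \det P ^+ m.
  by rewrite -det_mulmx mul_mx_adj det_scalar.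
have regPm := lregX (n := m) regP; apply: regPm => /=.
rewrite -[in LHS]dadj; transitivity (\det P ^+ m * \det S * \det P).
  by rewrite -e; ring.
by ring.
Qed.

Lemma det_bordered (K : comNzRingType) m (P : 'M[K]_m) (x : 'cV_m) (y : 'rV_m)
    (d : K) : GRing.lreg (\det P) ->
  \det (block_mx P x y d%:M) = \det P * d - (y *m \adj P *m x) 0 0.
Proof.
move=> regP; apply: (regP); rewrite mulrC -[X in _ * X]expr1 det_schur //.
by rewrite det_mx11 !mxE eqxx mulr1n.
Qed.

(** By [det_bordered] the minors T k l are the entries of the 2 x 2 Schur complement of [P], whose
    determinant vanishes together with the large one. *)
Lemma bordered_minors_rank1 (K : comNzRingType) m (P : 'M[K]_m) (X : 'M_(m, 2))
    (Y : 'M_(2, m)) (D : 'M_2) : GRing.lreg (\det P) ->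
  \det (block_mx P X Y D) = 0 ->
  let T k l := \det (block_mx P (col l X) (row k Y) (D k l)%:M) in
  T 0 0 * T 1 1 = T 0 1 * T 1 0.
Proof.
move=> regP M0 T.
pose S := \det P *: D - Y *m \adj P *m X.
have TS k l : T k l = S k l.
  rewrite /T det_bordered // /S !mxE; congr (_ - _).
  apply: eq_bigr => i _; rewrite !mxE; congr (_ * _).
  by apply: eq_bigr => j _; rewrite !mxE.
rewrite !TS; have : \det P * \det S = 0 by rewrite -det_schur // M0 mul0r.
rewrite -[RHS](mulr0 (\det P)) => /regP /eqP.
rewrite det_mx22 subr_eq0 => /eqP; exact.
Qed.

Variable R : realType.

(** The identity permutation alone reaches the least degree, so nothing cancels its leading
    coefficient. *)
Lemma hdeg_det n (L : 'M[hahn R]_n) (d : 'I_n -> 'I_n -> R) :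
  (forall i j, hdeg_is (hval (L i j)) (d i j)) ->
  (forall s : 'S_n, s != 1%g -> \sum_i d i i < \sum_i d i (s i)) ->
  hdeg_is (hval (\det L)) (\sum_i d i i).
Proof.
move=> degL dmin; rewrite /determinant (bigD1 1%g) // odd_perm1 expr0 mul1r.
have -> : \prod_i L i ((1%g : 'S_n) i) = \prod_i L i i :> hahn R.
  by apply: eq_bigr => i _; rewrite perm1.
have [ge eq] := hge_prod (fun i => (degL i i).2).
set u := \prod_i _ in ge eq *; set v := \big[_/_]_(_ | _) _.
have gev x : x <= \sum_i d i i -> hval v x = 0.
  move=> xd; apply: (big_ind (fun w : hahn R => hval w x = 0)) => //.
    by move=> w1 w2 e1 e2; rewrite hvalD /hadd e1 e2 addr0.
  move=> s s1; have [ges _] := hge_prod (fun i => (degL i (s i)).2).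
  by rewrite (hge_sign _ ges) //; apply: le_lt_trans xd _; apply: dmin.
split.
  rewrite hvalD /hadd gev // addr0 eq prodf_seq_neq0.
  by apply/allP => i _; case: (degL i i).
by move=> x xd; rewrite hvalD /hadd ge // gev ?addr0 // ltW.
Qed.

(** On series of nonnegative degree, taking the coefficient at 0 respects sums and products. *)
Lemma det_residue n (L : 'M[hahn R]_n) : (forall i j, hge (L i j) 0) ->
  hval (\det L) 0 = \det (\matrix_(i, j) hval (L i j) 0).
Proof.
move=> geL; rewrite hval_sum; apply: eq_bigr => s _.
rewrite hval_sign /hscale; congr (_ * _).
have [_] := hge_prod (fun i => geL i (s i)).
by rewrite sumr_const mul0rn => ->; apply: eq_bigr => i _; rewrite mxE.
Qed.

End Determinants.

(** * Monomials in symmetric variables *)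

Section SymmetricMonomials.
Variable n : nat.
Implicit Types (I J : {set 'I_n}) (rho : 'I_n -> 'I_n).

Lemma monomialE I rho p : monomial I rho p =
  (\sum_(k in I) (((k, rho k) == p) || ((rho k, k) == p)))%N.
Proof.
rewrite ffunE -sum1_card big_mkcond [RHS]big_mkcond; apply: eq_bigr => k _.
by rewrite inE; case: (k \in I) => //=; case: (_ || _).
Qed.

Lemma eq_monomial I rho rho' : {in I, rho =1 rho'} ->
  monomial I rho = monomial I rho'.
Proof.
by move=> e; apply/ffunP => p; rewrite !monomialE; apply: eq_bigr => k /e ->.
Qed.

Lemma monomialD1 I rho i p : i \in I -> monomial I rho p =
  ((((i, rho i) == p) || ((rho i, i) == p)) + monomial (I :\ i) rho p)%N.
Proof. by move=> iI; rewrite !monomialE (big_setD1 i). Qed.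

(** Pairs with p.1 <= p.2 represent each unordered pair once, so the total of a symmetric weight
    depends on the monomial alone. This is how monomials are compared along a map of indices. *)
Lemma monomial_weight I rho (W : 'I_n -> 'I_n -> nat) :
  (forall k l, W k l = W l k) ->
  (\sum_(k in I) W k (rho k) =
   \sum_(p : 'I_n * 'I_n | (p.1 <= p.2)%N) W p.1 p.2 * monomial I rho p)%N.
Proof.
move=> Wsym; under [RHS]eq_bigr => p _ do rewrite monomialE big_distrr /=.
rewrite exchange_big /=; apply: eq_bigr => k _.
pose c := if (k <= rho k)%N then (k, rho k) else (rho k, k).
have cle : (c.1 <= c.2)%N by rewrite /c; case: (leqP k (rho k)) => [//|/ltnW].
have cP (p : 'I_n * 'I_n) : (p.1 <= p.2)%N ->
    ((k, rho k) == p) || ((rho k, k) == p) = (p == c).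
  move=> ple; apply/orP/eqP => [[]/eqP pE|->]; last first.
  - by rewrite /c; case: (leqP k (rho k)) => _; rewrite eqxx; [left|right].
  - move: ple; rewrite /c -pE /= => ple; case: (leqP k (rho k)) => // kr.
    have -> : rho k = k by apply/val_inj/eqP; rewrite eqn_leq ple.
    by [].
  - by move: ple; rewrite /c -pE /= => ->.
rewrite (bigD1 c) //= big1 ?addn0 => [|p /andP[ple pc]]; last first.
  by rewrite cP // (negbTE pc) muln0.
by rewrite cP // eqxx muln1 /c; case: (leqP k (rho k)).
Qed.

(* Exchanging two images always changes the monomial, because the exponent of
   X_(k, rho k) strictly drops. *)
Lemma monomial_swap I rho k l : {in I &, injective rho} ->
  k \in I -> l \in I -> k != l ->
  monomial I rho != monomial I (rho \o tperm k l).
Proof.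
move=> inj kI lI kl; apply/eqP => /ffunP /(_ (k, rho k)); rewrite !ffunE => e.
suff : [set x in I | ((x, (rho \o tperm k l) x) == (k, rho k)) ||
    (((rho \o tperm k l) x, x) == (k, rho k))] \proper
    [set x in I | ((x, rho x) == (k, rho k)) || ((rho x, x) == (k, rho k))].
  by move/proper_card; rewrite -e ltnn.
apply/properP; split; last first.
  exists k; rewrite !inE kI /= ?eqxx //= tpermL !xpair_eqE eqxx /=.
  have rkl : rho l != rho k by apply: contra_neq kl => /inj ->.
  rewrite (negbTE rkl) /=; apply/negP => /andP[/eqP lk /eqP kk].
  by rewrite lk -kk eqxx in rkl.
apply/fintype.subsetP => x; rewrite !inE /= => /andP[xI]; rewrite xI /= !xpair_eqE.
have [->|xk] := eqVneq x k; first by rewrite eqxx.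
have [->|xl] := eqVneq x l.
  rewrite tpermR /= => /andP[/eqP rk /eqP lr].
  by rewrite -rk lr eqxx in kl.
by rewrite tpermD // eq_sym.
Qed.

End SymmetricMonomials.

(** * Transfer of tropical singularity between matrices *)

Section SingularSubmatrices.
Variable R : realType.

Section OneMatrix.
Variables (n : nat) (A : 'M[R]_n).
Implicit Types (I J : {set 'I_n}) (rho : 'I_n -> 'I_n).

Definition optimal I J rho := is_bij I J rho /\
  forall rho', is_bij I J rho' -> mono_val A I rho <= mono_val A I rho'.

Lemma eq_mono_val I rho rho' : {in I, rho =1 rho'} ->
  mono_val A I rho = mono_val A I rho'.
Proof. by move=> e; apply: eq_bigr => k /e ->. Qed.

Lemma eq_is_bij I J rho rho' : {in I, rho =1 rho'} ->
  is_bij I J rho -> is_bij I J rho'.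
Proof.
move=> e [im inj]; split=> [k kI|k l kI lI]; first by rewrite -e // im.
by rewrite -!e //; apply: inj.
Qed.

Lemma is_bij_nth I J (p : seq 'I_n) : perm_eq p (enum J) ->
  size p = size (enum I) ->
  is_bij I J (fun k => nth k p (index k (enum I))).
Proof.
move=> pJ sp; have ix k : k \in I -> (index k (enum I) < size p)%N.
  by move=> kI; rewrite sp index_mem mem_enum.
split=> [k kI|k l kI lI].
  by rewrite -[_ \in J]mem_enum -(perm_mem pJ) mem_nth // ix.
rewrite (set_nth_default k l) ?ix // => /eqP.
rewrite nth_uniq ?ix // ?(perm_uniq pJ) ?enum_uniq // => /eqP.
by move/(congr1 (nth k (enum I))); rewrite !nth_index ?mem_enum.
Qed.

Lemma ex_optimal I J : #|I| = #|J| -> exists rho, optimal I J rho.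
Proof.
move=> cIJ.
(* Finite functions form a finite type, over which the minimum exists; [f0] matches the two
   enumerations in order. *)
pose f0 : {ffun 'I_n -> 'I_n} := [ffun k => nth k (enum J) (index k (enum I))].
have bf0 : `[< is_bij I J f0 >].
  apply/asboolP; apply: eq_is_bij (is_bij_nth (perm_refl _) _).
    by move=> k _; rewrite ffunE.
  by rewrite -!cardE.
case: (@Order.TotalTheory.arg_minP _ R {ffun 'I_n -> 'I_n} f0
  (fun f => `[< is_bij I J f >]) (fun f => mono_val A I f) bf0).
move=> f /asboolP bf fmin; exists f; split=> // rho brho.
rewrite (@eq_mono_val _ rho (finfun rho)); last by move=> k _; rewrite ffunE.
by apply: fmin; apply/asboolP; apply: eq_is_bij brho => k _; rewrite ffunE.
Qed.

Lemma is_bij_surj I J rho j : #|I| = #|J| -> is_bij I J rho -> j \in J ->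
  exists2 i, i \in I & rho i = j.
Proof.
move=> cIJ [im inj] jJ.
have : rho @: I = J.
  apply/eqP; rewrite eqEcard card_in_imset // cIJ leqnn andbT.
  by apply/fintype.subsetP => _ /imsetP[k kI ->]; apply: im.
by move=> imE; move: jJ; rewrite -imE => /imsetP[i iI ->]; exists i.
Qed.

Lemma tperm_mem (T : finType) (I : {set T}) k l x :
  k \in I -> l \in I -> (tperm k l x \in I) = (x \in I).
Proof. by move=> kI lI; case: tpermP => [->|->|]; rewrite ?kI ?lI. Qed.

Lemma is_bij_swap I J rho k l : is_bij I J rho -> k \in I -> l \in I ->
  is_bij I J (rho \o tperm k l).
Proof.
move=> [im inj] kI lI; split=> [x xI|x y xI yI] /=.
  by apply: im; rewrite tperm_mem.
by move/inj; rewrite !tperm_mem // => /(_ xI yI) /perm_inj.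
Qed.

Lemma singular_swap I J rho k l : optimal I J rho ->
  k \in I -> l \in I -> k != l ->
  mono_val A I (rho \o tperm k l) = mono_val A I rho ->
  sym_trop_singular A I J.
Proof.
move=> [brho rhomin] kI lI kl e; exists rho, (rho \o tperm k l); split=> //.
- exact: is_bij_swap.
- by apply: monomial_swap => //; case: brho.
Qed.

(** Two tied optima of the smaller submatrix extend by i -> rho i. They stay optimal because [rho]
    restricts to a competitor there, and their monomials stay distinct because the common factor
    cancels. *)
Lemma singular_expand I J rho i : optimal I J rho -> i \in I ->
  sym_trop_singular A (I :\ i) (J :\ rho i) -> sym_trop_singular A I J.
Proof.
move=> [[im inj] rhomin] iI [r1 [r2 [b1 b2 m12 v12 v1min]]].
pose ext r k := if k == i then rho i else r k.
have extE r : {in I :\ i, ext r =1 r}.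
  by move=> k /setD1P[ki _]; rewrite /ext (negbTE ki).
have exti r : ext r i = rho i by rewrite /ext eqxx.
have bext r : is_bij (I :\ i) (J :\ rho i) r -> is_bij I J (ext r).
  move=> [imr injr]; split=> [k kI|k l kI lI]; rewrite /ext.
    have [_|ki] := eqVneq k i; first exact: im.
    by have := imr k; rewrite !inE ki kI => /(_ isT) /andP[].
  have rN x : x \in I -> x != i -> r x != rho i.
    by move=> xI xi; have := imr x; rewrite !inE xI xi => /(_ isT) /andP[].
  have [->|ki] := eqVneq k i; have [->|li] := eqVneq l i => //.
  - by move=> e; have := rN l lI li; rewrite e eqxx.
  - by move=> e; have := rN k kI ki; rewrite e eqxx.
  - by apply: injr; rewrite !inE ?ki ?li.
have vext r : mono_val A I (ext r) = A i (rho i) + mono_val A (I :\ i) r.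
  by rewrite /mono_val (big_setD1 i) //= exti; congr (_ + _);
    apply: eq_bigr => k /extE ->.
exists (ext r1), (ext r2); split; [exact: bext | exact: bext | | |].
- apply: contraNneq m12 => /ffunP e; apply/eqP/ffunP => p.
  have := e p; rewrite !(monomialD1 _ _ iI) !exti => /addnI.
  by rewrite !(eq_monomial (extE _)).
- by rewrite !vext v12.
- move=> r br; apply: le_trans (rhomin _ br).
  rewrite vext {2}/mono_val (big_setD1 i) //= lerD2l; apply: v1min.
  split=> [k|k l].
    rewrite !inE => /andP[ki kI]; rewrite im // andbT.
    by apply: contra_neq ki; apply: inj.
  by rewrite !inE => /andP[_ kI] /andP[_ lI]; apply: inj.
Qed.

End OneMatrix.

Lemma ex_section (T U : finType) (phi : T -> U) (x0 : T) (J : {set T}) :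
  {in J &, injective phi} ->
  exists psi : U -> T, {in J, cancel phi psi}.
Proof.
move=> inj; exists (fun u => odflt x0 [pick x in J | phi x == u]) => x xJ.
case: pickP => [y /andP[yJ /eqP/inj]|/(_ x)]; first exact.
by rewrite xJ eqxx.
Qed.

(** Bijections correspond through [phi]. Since [phi] may merge an index of [I] with one of [J], it
    can identify variables; but monomials distinct after [phi] were distinct before. *)
Lemma singular_pullback m n (A : 'M[R]_m) (B : 'M[R]_n) (phi : 'I_n -> 'I_m)
    (I J : {set 'I_n}) (x0 : 'I_n) :
  {in I &, injective phi} -> {in J &, injective phi} ->
  (forall i j, i \in I -> j \in J -> B i j = A (phi i) (phi j)) ->
  sym_trop_singular A (phi @: I) (phi @: J) -> sym_trop_singular B I J.
Proof.
move=> injI injJ AB [r1 [r2 [b1 b2 m12 v12 v1min]]].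
have [chi chiK] := ex_section x0 injI; have [psi psiK] := ex_section x0 injJ.
have psiP j : j \in phi @: J -> psi j \in J /\ phi (psi j) = j.
  by move=> /imsetP[x xJ ->]; rewrite psiK.
pose pull r k := psi (r (phi k)).
have pullP r k : is_bij (phi @: I) (phi @: J) r -> k \in I ->
    pull r k \in J /\ phi (pull r k) = r (phi k).
  by move=> [im _] kI; apply/psiP/im/imset_f.
have bpull r : is_bij (phi @: I) (phi @: J) r -> is_bij I J (pull r).
  move=> br; split=> [k kI|k l kI lI]; first by case: (pullP r k br kI).
  move/(congr1 phi); rewrite (pullP r k br kI).2 (pullP r l br lI).2.
  by move/(br.2 _ _ (imset_f _ kI) (imset_f _ lI)); apply: injI.
have vpull r : is_bij (phi @: I) (phi @: J) r ->
    mono_val B I (pull r) = mono_val A (phi @: I) r.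
  move=> br; rewrite /mono_val big_imset //=; apply: eq_bigr => k kI.
  by have [pJ pE] := pullP r k br kI; rewrite AB // pE.
exists (pull r1), (pull r2); split; [exact: bpull | exact: bpull | | |].
- apply: contraNneq m12 => e; apply/eqP/ffunP => p.
  (* The exponent of X_p after [phi] is the total of this symmetric weight, hence determined by the
     monomial before [phi]. *)
  pose W (k l : 'I_n) : nat := ((phi k, phi l) == p) || ((phi l, phi k) == p).
  have monoW r : is_bij (phi @: I) (phi @: J) r ->
      monomial (phi @: I) r p = (\sum_(k in I) W k (pull r k))%N.
    move=> br; rewrite monomialE big_imset //=; apply: eq_bigr => k kI.
    by rewrite /W (pullP r k br kI).2.
  have Wsym k l : W k l = W l k by rewrite /W orbC.
  by rewrite !monoW // !(monomial_weight _ _ Wsym) e.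
- by rewrite !vpull.
- move=> r [im inj]; rewrite vpull //.
  pose push k := phi (r (chi k)).
  have -> : mono_val B I r = mono_val A (phi @: I) push.
    rewrite /mono_val big_imset //=; apply: eq_bigr => k kI.
    by rewrite /push chiK // AB // im.
  apply: v1min; split.
    by move=> _ /imsetP[k kI ->]; rewrite /push chiK // imset_f // im.
  move=> _ _ /imsetP[k kI ->] /imsetP[l lI ->]; rewrite /push !chiK //.
  by move/injJ; rewrite !im // => /(_ isT isT) /inj ->.
Qed.

Lemma noninjectiveP (T U : finType) (f : T -> U) (I : {set T}) :
  {in I &, injective f} \/
  exists k l, [/\ k \in I, l \in I, k != l & f k = f l].
Proof.
have [inj|ninj] := pselect ({in I &, injective f}); first by left.
right; apply: contrapT => no; apply: ninj => k l kI lI e.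
by apply/eqP; apply/negPn/negP => kl; apply: no; exists k, l.
Qed.

(** If [phi] merges two indices of [I], or two of [J], the equal rows or columns give a tie by
    [singular_swap]; otherwise the submatrix is a copy of one of [A]. *)
Lemma singular_blowup m n (A : 'M[R]_m) (phi : 'I_n -> 'I_m) (r : nat) :
  (0 < r)%N ->
  (forall I J : {set 'I_m}, #|I| = r -> #|J| = r -> sym_trop_singular A I J) ->
  forall I J : {set 'I_n}, #|I| = r -> #|J| = r ->
    sym_trop_singular (\matrix_(i, j) A (phi i) (phi j)) I J.
Proof.
move=> r0 singA I J cI cJ; set B := \matrix_(_, _) _.
have cIJ : #|I| = #|J| by rewrite cI cJ.
have [rho orho] := ex_optimal B cIJ.
have [x0 _] : exists x, x \in I by apply/card_gt0P; rewrite cI.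
have [injI|[k [l [kI lI kl e]]]] := noninjectiveP phi I; last first.
  apply: (singular_swap orho kI lI kl); rewrite /mono_val.
  rewrite (reindex_inj (@perm_inj _ (tperm k l))) /=.
  apply: eq_big => [x|x xI]; first by rewrite tperm_mem.
  by rewrite tpermK !mxE; congr (A _ _); case: tpermP => // ->.
have [injJ|[k' [l' [kJ lJ kl e]]]] := noninjectiveP phi J; last first.
  have [k kI ek] := is_bij_surj cIJ orho.1 kJ.
  have [l lI el] := is_bij_surj cIJ orho.1 lJ.
  apply: (singular_swap orho kI lI).
    by apply: contra_neq kl => kl; rewrite -ek -el kl.
  apply: eq_bigr => x xI; rewrite !mxE; congr (A _ _) => /=.
  by case: tpermP => // ->; rewrite ek el.
apply: (@singular_pullback _ _ A _ phi _ _ x0) => //.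
  by move=> i j _ _; rewrite mxE.
by apply: singA; rewrite card_in_imset.
Qed.

End SingularSubmatrices.

(** * Gaps and the two ways to enlarge them *)

Section Gap.
Variable R : realType.

Definition gap (m r : nat) := exists A : 'M[R]_m, [/\ A^T = A,
  forall I J : {set 'I_m}, #|I| = r -> #|J| = r -> sym_trop_singular A I J &
  ~ exists L, sym_lift A L /\ rank_le_pred r L].

Lemma gap_not_basis m r : gap m r -> ~ minors_tropical_basis R m r.
Proof. by move=> [A [symA singA noL]] /(_ A symA)[/(_ singA)]. Qed.

Lemma gap_blowup m n r : (0 < m)%N -> (m <= n)%N -> (0 < r)%N ->
  gap m r -> gap n r.
Proof.
case: m => // m _ mn r0 [A [symA singA noL]].
(* [inord] sends every index outside the range of [A] to 0, so row and column 0 are the repeated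
   ones. *)
pose phi (i : 'I_n) : 'I_m.+1 := inord i.
have phiK i : phi (widen_ord mn i) = i by rewrite /phi inord_val.
exists (\matrix_(i, j) A (phi i) (phi j)); split.
- by apply/matrixP => i j; rewrite !mxE -[in LHS]symA mxE.
- exact: singular_blowup.
move=> [L [[symL [hL [nzL degL]]] rkL]]; apply: noL.
exists (fun i j => L (widen_ord mn i) (widen_ord mn j)); split.
  do !split=> //; have := degL (widen_ord mn i) (widen_ord mn j);
  by rewrite mxE !phiK => -[].
move=> f g injf injg.
have winj : injective (widen_ord mn) by move=> i j /(congr1 val) /= /val_inj.
by apply: (rkL (widen_ord mn \o f) (widen_ord mn \o g)); apply: inj_comp.
Qed.

Lemma sym_lift_hahn m (A : 'M[R]_m) L : sym_lift A L ->
  exists2 H : 'I_m -> 'I_m -> hahn R, L = fun i j => hval (H i j) &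
  (forall i j, H i j = H j i) /\
  (forall i j, hdeg_is (hval (H i j)) (A i j)).
Proof.
move=> [symL [hL [_ degL]]]; exists (fun i j => Hahn (L i j) (hL i j)) => //.
by split=> // i j; apply: hval_inj; apply: symL.
Qed.

Lemma hahn_sym_lift m (A : 'M[R]_m) (H : 'I_m -> 'I_m -> hahn R) :
  (forall i j, H i j = H j i) ->
  (forall i j, hdeg_is (hval (H i j)) (A i j)) ->
  sym_lift A (fun i j => hval (H i j)).
Proof.
move=> symH degH; split=> [i j|]; first by rewrite symH.
split=> [i j|]; first exact: hvalP.
by split=> // i j e; have [] := degH i j; rewrite e /hzero eqxx.
Qed.

Lemma rank_hahn m r (H : 'I_m -> 'I_m -> hahn R) :
  rank_le_pred r (fun i j => hval (H i j)) <->
  forall f g : 'I_r -> 'I_m, injective f -> injective g ->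
    \det (\matrix_(i, j) H (f i) (g j)) = 0.
Proof.
split=> rk f g injf injg; last by rewrite hminorE rk.
by apply: hval_inj; rewrite -hminorE rk.
Qed.

Definition border m (M : R) (A : 'M[R]_m) : 'M[R]_m.+1 :=
  \matrix_(i, j) match unlift ord0 i, unlift ord0 j with
    | Some a, Some b => A a b
    | None, None => 0
    | _, _ => M
    end.

Lemma border00 m M (A : 'M[R]_m) : border M A ord0 ord0 = 0.
Proof. by rewrite mxE unlift_none. Qed.
Lemma border0l m M (A : 'M[R]_m) j : border M A ord0 (lift ord0 j) = M.
Proof. by rewrite mxE unlift_none liftK. Qed.
Lemma borderl0 m M (A : 'M[R]_m) i : border M A (lift ord0 i) ord0 = M.
Proof. by rewrite mxE unlift_none liftK. Qed.
Lemma borderll m M (A : 'M[R]_m) i j :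
  border M A (lift ord0 i) (lift ord0 j) = A i j.
Proof. by rewrite mxE !liftK. Qed.

(** A bijection moving the new index pays M twice; sending the new index to itself and joining the
    two freed ends costs only 0 + A i j. *)
Lemma optimal_border m M (A : 'M[R]_m) (I J : {set 'I_m.+1}) rho :
  (forall i j, A i j < M + M) -> #|I| = #|J| -> optimal (border M A) I J rho ->
  ord0 \in I -> ord0 \in J -> rho ord0 = ord0.
Proof.
move=> Mbig cIJ [brho rhomin] I0 J0; apply/eqP/negPn/negP => r0.
have [k kI rk] := is_bij_surj cIJ brho J0.
have k0 : k != ord0 by apply: contra_neq r0 => k0; rewrite -{1}k0.
have := rhomin _ (is_bij_swap brho I0 kI); rewrite leNgt => /negP; apply.
have kI' : k \in I :\ ord0 by rewrite !inE k0.
rewrite /mono_val !(big_setD1 ord0 I0) /= !(big_setD1 k kI') /= tpermL tpermR.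
rewrite rk border00 (eq_bigr (fun x => border M A x (rho x))); last first.
  by move=> x; rewrite !inE => /and3P[xk x0 _]; rewrite tpermD // eq_sym.
have -> : border M A k ord0 = M.
  by case: (unliftP ord0 k) k0 => [j ->|->] //; rewrite borderl0.
have [j rj] : exists j, rho ord0 = lift ord0 j.
  by case: (unliftP ord0 (rho ord0)) r0 => [j ->|->] //; exists j.
have [i ki] : exists i, k = lift ord0 i.
  by case: (unliftP ord0 k) k0 => [i ->|->] //; exists i.
by rewrite rj ki border0l borderll; have := Mbig i j; lra.
Qed.

Lemma gap_border m r : (0 < m)%N -> gap m r -> gap m.+1 r.+1.
Proof.
case: m => // m _ [A [symA singA noL]].
(* [M] exceeds every entry of [A] and is positive, so 2M exceeds every entry as well. *)
pose M : R := 1 + \sum_i \sum_j `|A i j|.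
have AM i j : A i j < M.
  rewrite /M (bigD1 i) //= (bigD1 j) //=.
  have := ler_norm (A i j).
  have : 0 <= \sum_(l | l != j) `|A i l| by apply: sumr_ge0.
  have : 0 <= \sum_(k | k != i) \sum_l `|A k l|.
    by apply: sumr_ge0 => k _; apply: sumr_ge0.
  by lra.
have M1 : 1 <= M by rewrite lerDl; apply: sumr_ge0 => i _; apply: sumr_ge0.
have AMM i j : A i j < M + M by have := AM i j; lra.
exists (border M A); split.
- apply/matrixP => i j; rewrite !mxE; case: unlift => [a|]; case: unlift => [b|] //.
  by rewrite -[in LHS]symA mxE.
- move=> I J cI cJ; have cIJ : #|I| = #|J| by rewrite cI cJ.
  have [rho orho] := ex_optimal (border M A) cIJ.
  (* A row [i] is sought whose removal, with its image, takes the new index away from both sides: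
     the new index itself if it is in [I], else its preimage if it is in [J], else any row. *)
  have [i iI [Ni Nr]] : exists2 i, i \in I &
      ord0 \notin I :\ i /\ ord0 \notin J :\ rho i.
    have [I0|I0] := boolP (ord0 \in I).
      exists ord0 => //; rewrite !inE eqxx; split=> //.
      have [J0|J0] := boolP (ord0 \in J); last by rewrite andbF.
      by rewrite (optimal_border AMM cIJ orho I0 J0) eqxx.
    have [J0|J0] := boolP (ord0 \in J).
      have [i iI ri] := is_bij_surj cIJ orho.1 J0.
      by exists i => //; rewrite !inE (negbTE I0) ri eqxx andbF.
    have [i iI] : exists i, i \in I by apply/card_gt0P; rewrite cI.
    by exists i => //; rewrite !inE (negbTE I0) (negbTE J0) !andbF.
  apply: (singular_expand orho iI).
  pose phi (k : 'I_m.+2) : 'I_m.+1 := odflt ord0 (unlift ord0 k).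
  have phiK k : k != ord0 -> lift ord0 (phi k) = k.
    by case: (unliftP ord0 k) => [j ->|->] //; rewrite /phi liftK.
  have inj_phi (K : {set 'I_m.+2}) : ord0 \notin K -> {in K &, injective phi}.
    move=> K0 k l kK lK /(congr1 (lift ord0)).
    by rewrite !phiK //; apply: contraNneq K0 => <-.
  apply: (@singular_pullback _ _ _ A _ phi _ _ ord0); try exact: inj_phi.
    move=> k l kK lK; rewrite -(borderll M A (phi k)) !phiK //.
      by apply: contraNneq Nr => <-.
    by apply: contraNneq Ni => <-.
  apply: singA; rewrite card_in_imset; try exact: inj_phi.
    by have := cardsD1 i I; rewrite iI cI => -[].
  by have := cardsD1 (rho i) J; rewrite (orho.1.1 _ iI) cJ => -[].
move=> [L [liftL rkL]]; apply: noL.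
have [H LE [symH degH]] := sym_lift_hahn liftL.
move: rkL; rewrite LE => /rank_hahn rkH {L LE liftL}.
pose c := H ord0 ord0.
have degc : hdeg_is (hval c) 0 by have := degH ord0 ord0; rewrite border00.
(* Chio condensation: the Schur complement of the new diagonal entry, scaled. *)
pose L i j := c * H (lift ord0 i) (lift ord0 j)
  - H (lift ord0 i) ord0 * H ord0 (lift ord0 j).
exists (fun i j => hval (L i j)); split.
  apply: hahn_sym_lift => i j.
    by rewrite /L (symH (lift ord0 i)) (symH ord0 (lift ord0 j)) mulrC
      [X in _ - X]mulrC (symH (lift ord0 i) ord0) mulrC.
  have degll := degH (lift ord0 i) (lift ord0 j); rewrite borderll in degll.
  have [nz ge] := hdegM degc degll; rewrite add0r in nz ge.
  have := degH (lift ord0 i) ord0; rewrite borderl0 => -[_ gel0].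
  have := degH ord0 (lift ord0 j); rewrite border0l => -[_ ge0l].
  have [geMM _] := hgeM gel0 ge0l.
  (* The correction term has degree at least 2M > A i j, so it leaves the leading term of [L i j]
     untouched. *)
  have zN x : x < M + M -> hval (- (H (lift ord0 i) ord0 * H ord0 (lift ord0 j))) x = 0.
    exact: hgeN.
  split; first by rewrite hvalD /hadd zN ?addr0.
  by move=> x xA; rewrite hvalD /hadd ge // zN ?addr0 //; apply: lt_trans (AMM i j).
apply/rank_hahn => f g injf injg.
(* The minor of [H] with the new index placed first among both rows and columns. *)
pose ext (h : 'I_r -> 'I_m.+1) (i : 'I_(1 + r)) : 'I_m.+2 :=
  if fintype.split i is inr k then lift ord0 (h k) else ord0.
have inj_ext h : injective h -> injective (ext h).
  move=> injh i j; rewrite /ext => e; rewrite -(splitK i) -(splitK j); move: e.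
  case: (fintype.split i) => i'; case: (fintype.split j) => j' //=.
    by rewrite (ord1 i') (ord1 j').
  by move/lift_inj/injh ->.
have := rkH (ext f) (ext g) (inj_ext _ injf) (inj_ext _ injg).
set N := \matrix_(_, _) _ => N0.
pose P : 'M[hahn R]_1 := c%:M.
pose X : 'M[hahn R]_(1, r) := \matrix_(_, j) H ord0 (lift ord0 (g j)).
pose Y : 'M[hahn R]_(r, 1) := \matrix_(i, _) H (lift ord0 (f i)) ord0.
pose D : 'M[hahn R]_r := \matrix_(i, j) H (lift ord0 (f i)) (lift ord0 (g j)).
have NE : N = block_mx P X Y D.
  apply/matrixP => i j; rewrite [LHS]mxE /ext.
  rewrite -[in RHS](@splitK 1 r i) -[in RHS](@splitK 1 r j).
  case: (@fintype.split 1 r i) => i'; case: (@fintype.split 1 r j) => j' /=.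
  - by rewrite [RHS](@block_mxEul _ 1 r 1 r) mxE (ord1 i') (ord1 j') eqxx mulr1n.
  - by rewrite [RHS](@block_mxEur _ 1 r 1 r) mxE.
  - by rewrite [RHS](@block_mxEdl _ 1 r 1 r) mxE.
  - by rewrite [RHS](@block_mxEdr _ 1 r 1 r) mxE.
have detP : \det P = c by rewrite det_scalar1.
have regP : GRing.lreg (\det P) by rewrite detP; apply: hdeg_lreg degc.
(* The adjugate of a 1 x 1 matrix is 1, so the scaled Schur complement of [c] in [N] is the
   submatrix of [L]; [c] times its determinant vanishes, and [c] cancels. *)
have := det_schur X Y D regP; rewrite -NE N0 mul0r => e.
apply: (regP); rewrite mulr0 {}e; congr (_ * \det _).
apply/matrixP => i j; rewrite !mxE big_ord1 !mxE big_ord1 !mxE detP.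
by rewrite /cofactor det_mx00 expr0 !mulr1.
Qed.

End Gap.

(** * Enumeration of assignments by cost *)

Section Assignments.
Variables (T : eqType) (a : T -> T -> nat).
Implicit Types (s t p l : seq T).

(** Lists the arrangements of [t], paired with [s] position by position, of cost exactly [v].
    Entries above the remaining budget are pruned, which also guards the truncated subtraction. *)
Fixpoint assignments s t (v : nat) : seq (seq T) :=
  if s is i :: s' then
    flatten [seq (if (a i j <= v)%N
                  then [seq j :: p | p <- assignments s' (rem j t) (v - a i j)]
                  else [::]) | j <- t]
  else if v is 0 then [:: [::]] else [::].

Definition cost s p := (\sum_(x <- zip s p) a x.1 x.2)%N.

Lemma mem_assignments s t v p : size s = size t ->
  (p \in assignments s t v) = perm_eq p t && (cost s p == v).
Proof.
elim: s t v p => [|i s IHs] t v p /= sz.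
  case: t sz => // _; have -> : cost [::] p = 0%N by case: p => *; rewrite /cost big_nil.
  case: v => [|v]; last by rewrite andbF.
  by rewrite inE andbT; case: p => //= x p; apply/esym/negP => /perm_size.
apply/flattenP/andP => [[_ /mapP[j jt ->]]|[pt /eqP <-]].
  case: leqP => // av /mapP[q]; rewrite IHs ?size_rem -?sz //.
  move=> /andP[qt /eqP cq] ->; rewrite /cost /= big_cons /= -/(cost s q) cq.
  rewrite subnKC // eqxx; split=> //.
  by rewrite perm_sym (perm_trans (perm_to_rem jt)) // perm_cons perm_sym.
case: p pt => [|j q] pt; first by move/perm_size: pt; rewrite -sz.
have jt : j \in t by rewrite -(perm_mem pt) mem_head.
eexists; first by apply/mapP; exists j; [exact: jt | reflexivity].
rewrite /cost /= big_cons /= leq_addr; apply/mapP; exists q => //.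
rewrite IHs ?size_rem -?sz // addKn eqxx andbT -(perm_cons j).
by rewrite (perm_trans pt) // perm_to_rem.
Qed.

Definition mcount s p (q : T * T) :=
  count (fun x => (x == q) || ((x.2, x.1) == q)) (zip s p).

(** Costs are tried upwards, so the first nonempty list holds the optima. Exponents at the pairs of
    [p] suffice: two monomials of equal degree that agree there coincide. *)
Fixpoint min_tie (fuel : nat) s t (v : nat) : bool :=
  if fuel is k.+1 then
    if assignments s t v is p :: ps then
      has (fun p' => has (fun q => mcount s p q != mcount s p' q) (zip s p)) ps
    else min_tie k s t v.+1
  else false.

Lemma min_tieP fuel s t v :
  (forall w, (w < v)%N -> assignments s t w = [::]) -> min_tie fuel s t v ->
  exists v0 p p' q, [/\ p \in assignments s t v0, p' \in assignments s t v0,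
    mcount s p q != mcount s p' q &
    forall w, (w < v0)%N -> assignments s t w = [::]].
Proof.
elim: fuel v => //= fuel IHf v lt0; case E: (assignments s t v) => [|p ps].
  by apply: IHf => w; rewrite ltnS leq_eqVlt => /orP[/eqP ->|/lt0].
case/hasP => p' p'in /hasP[q _ neq]; exists v, p, p', q.
by rewrite E mem_head inE p'in orbT.
Qed.

(** A computable form of the hypothesis of [hdeg_det]: [t] is ordered so that the diagonal is the
    only optimum. *)
Definition uniq_min s t (v : nat) :=
  (assignments s t v == [:: t]) &&
  all (fun w => assignments s t w == [::]) (iota 0 v).

Lemma uniq_minP s t v p : size s = size t -> uniq_min s t v -> perm_eq p t ->
  p != t -> (cost s t == v) && (v < cost s p)%N.
Proof.
move=> sz /andP[/eqP av /allP lt0] pt pNt.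
have := mem_head t [::]; rewrite -av mem_assignments // => /andP[_ ->] /=.
have pin : p \in assignments s t (cost s p) by rewrite mem_assignments // pt eqxx.
rewrite ltnNge leq_eqVlt; apply/negP => /orP[/eqP e|lt].
  by move: pin; rewrite e av inE (negbTE pNt).
by have := lt0 (cost s p); rewrite mem_iota lt => /(_ isT) /eqP e; rewrite e in pin.
Qed.

(** Index sets are tested through their enumerations, which are subsequences of the full one. *)
Fixpoint all_subseq l (k : nat) (P : pred (seq T)) : bool :=
  if k is k'.+1 then
    if l is x :: l' then
      all_subseq l' k' (fun s => P (x :: s)) && all_subseq l' k P
    else true
  else P [::].

Lemma all_subseqP l k (P : pred (seq T)) s : all_subseq l k P ->
  subseq s l -> size s = k -> P s.
Proof.
elim: l k P s => [|x l IHl] k P s.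
  by case: k => [|k] h; rewrite subseq0 => /eqP ->.
case: k => [|k] /= ; first by move=> + _ /size0nil ->.
case: s => // y s /andP[h1 h2] /=; case: eqP => [->|_] sub [sz].
  exact: (IHl _ _ _ h1).
by apply: (IHl _ _ _ h2) => //=; rewrite sz.
Qed.

End Assignments.

(** * Soundness of the computed certificates *)

Section Certificates.
Variables (R : realType) (n : nat) (a : 'I_n -> 'I_n -> nat).

Lemma cost_map (s : seq 'I_n) rho :
  cost a s (map rho s) = (\sum_(k <- s) a k (rho k))%N.
Proof.
by elim: s => [|k s IHs]; rewrite /cost /= ?big_nil // !big_cons /= -IHs.
Qed.

Lemma mcount_map (I : {set 'I_n}) rho q :
  mcount (enum I) (map rho (enum I)) q = monomial I rho q.
Proof.
rewrite monomialE -[RHS]big_enum /=; elim: (enum I) => [|k s IHs].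
  by rewrite big_nil.
by rewrite big_cons -IHs.
Qed.

(** [l] is [enum 'I_n] written out explicitly, so that the test evaluates. *)
Lemma singular_check (l : seq 'I_n) fuel r :
  l = enum 'I_n ->
  all_subseq l r (fun s => all_subseq l r (fun t => min_tie a fuel s t 0)) ->
  forall I J : {set 'I_n}, #|I| = r -> #|J| = r ->
    sym_trop_singular (\matrix_(i, j) (a i j)%:R : 'M[R]_n) I J.
Proof.
move=> -> chk I J cI cJ; set A := \matrix_(_, _) _.
have sub (K : {set 'I_n}) : subseq (enum K) (enum 'I_n).
  by rewrite {1}/enum_mem -enumT; apply: filter_subseq.
have sz : size (enum I) = size (enum J) by rewrite -!cardE cI cJ.
have tie : min_tie a fuel (enum I) (enum J) 0.
  have h := all_subseqP chk (sub I) (etrans (esym (cardE _)) cI).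
  exact: (all_subseqP h (sub J) (etrans (esym (cardE _)) cJ)).
have val rho : mono_val A I rho = (cost a (enum I) (map rho (enum I)))%:R.
  rewrite cost_map natr_sum big_enum; apply: eq_bigr => k _; by rewrite mxE.
have [//|v [p [p' [q [pin p'in neq lt0]]]]] := min_tieP _ tie.
pose rho_ (p : seq 'I_n) k := nth k p (index k (enum I)).
have rhoE (u : seq 'I_n) : u \in assignments a (enum I) (enum J) v ->
    [/\ is_bij I J (rho_ u), map (rho_ u) (enum I) = u & cost a (enum I) u = v].
  rewrite mem_assignments // => /andP[uJ /eqP cu].
  have su : size u = size (enum I) by rewrite (perm_size uJ).
  split=> //; first exact: is_bij_nth.
  case E : (enum I) => [|x0 s0]; first by rewrite E in su; rewrite (size0nil su).
  rewrite -E; apply: (@eq_from_nth _ x0) => [|i]; rewrite size_map // => ilt.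
  rewrite (nth_map x0) // /rho_ index_uniq ?enum_uniq //.
  by apply: set_nth_default; rewrite su.
have [b mp cp] := rhoE _ pin; have [b' mp' cp'] := rhoE _ p'in.
exists (rho_ p), (rho_ p'); split=> //.
- apply: contraNneq neq => e.
  by rewrite -{1}mp -{1}mp' !mcount_map e.
- by rewrite !val mp mp' cp cp'.
move=> rho [im inj]; rewrite !val mp cp ler_nat leqNgt; apply/negP => lt.
(* A cheaper bijection would appear in a list of assignments already found empty. *)
have : map rho (enum I) \in
    assignments a (enum I) (enum J) (cost a (enum I) (map rho (enum I))).
  rewrite mem_assignments // eqxx andbT; apply: uniq_perm.
  - rewrite map_inj_in_uniq ?enum_uniq // => k k'; rewrite !mem_enum; exact: inj.
  - exact: enum_uniq.
  - have sJ : {subset map rho (enum I) <= enum J}.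
      by move=> _ /mapP[k kI ->]; rewrite mem_enum im // -mem_enum.
    apply: (uniq_min_size _ sJ _).2; rewrite ?size_map ?sz //.
    by rewrite map_inj_in_uniq ?enum_uniq // => k k'; rewrite !mem_enum; exact: inj.
by rewrite lt0.
Qed.

Lemma hdeg_det_check m (H : 'I_n -> 'I_n -> hahn R) (f g : 'I_m -> 'I_n) v :
  (forall i j, hdeg_is (hval (H i j)) (a i j)%:R) -> injective g ->
  uniq_min a [seq f i | i <- enum 'I_m] [seq g i | i <- enum 'I_m] v ->
  hdeg_is (hval (\det (\matrix_(i, j) H (f i) (g j)))) v%:R.
Proof.
move=> degH injg um; set s := map f _ in um; set t := map g _ in um.
have sz : size s = size t by rewrite !size_map.
have costE (sg : 'S_m) :
    cost a s [seq g (sg i) | i <- enum 'I_m] = (\sum_i a (f i) (g (sg i)))%N.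
  by rewrite /cost zip_map big_map /= big_enum.
have cv : cost a s t = v.
  case/andP: um => /eqP av _; have := mem_head t [::].
  by rewrite -av mem_assignments // => /andP[_ /eqP].
have sumE : \sum_i (a (f i) (g i))%:R = v%:R :> R.
  rewrite -natr_sum -cv /cost /s /t zip_map big_map /= big_enum //.
rewrite -sumE; apply: (hdeg_det (d := fun i j => (a (f i) (g j))%:R)).
  by move=> i j; rewrite mxE.
move=> sg sg1; rewrite sumE -natr_sum ltr_nat -costE.
have [] : perm_eq [seq g (sg i) | i <- enum 'I_m] t /\
    [seq g (sg i) | i <- enum 'I_m] != t.
  split.
    rewrite (map_comp g sg); apply: perm_map; apply: uniq_perm.
    - by rewrite map_inj_uniq ?enum_uniq //; apply: perm_inj.
    - exact: enum_uniq.
    by move=> i; rewrite mem_enum; apply/mapP; exists (sg^-1%g i);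
      rewrite ?mem_enum ?permKV.
  apply: contra_neq sg1 => /eq_in_map e; apply/permP => i.
  by rewrite perm1; apply/injg/e; rewrite mem_enum.
by move=> pt pNt; case/andP: (uniq_minP sz um pt pNt).
Qed.

End Certificates.

(** * The two example matrices *)

Definition entry n (M : seq (seq nat)) (i j : 'I_n) := nth 0%N (nth [::] M i) j.

(* Zero 2 x 2 blocks in block positions (1,1), (2,3), (3,2); each other block has
   a single entry smaller than 4. *)
Definition shitov6 := [:: [:: 0; 0; 4; 4; 4; 4];
                          [:: 0; 0; 4; 2; 4; 2];
                          [:: 4; 4; 4; 4; 0; 0];
                          [:: 4; 2; 4; 2; 0; 0];
                          [:: 4; 4; 0; 0; 4; 4];
                          [:: 4; 2; 0; 0; 4; 3]]%N.

Definition ord6 : seq 'I_6 := [:: @Ordinal 6 0 isT; @Ordinal 6 1 isT;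
  @Ordinal 6 2 isT; @Ordinal 6 3 isT; @Ordinal 6 4 isT; @Ordinal 6 5 isT].

(* The points 001, 010, 101, 102, 110, 111, 112, 120, 121 of P^2(F_3); an entry is 1
   when the scalar product of the two points vanishes. *)
Definition pg9 := [:: [:: 0; 1; 0; 0; 1; 0; 0; 1; 0];
                      [:: 1; 0; 1; 1; 0; 0; 0; 0; 0];
                      [:: 0; 1; 0; 1; 0; 0; 1; 0; 0];
                      [:: 0; 1; 1; 0; 0; 1; 0; 0; 1];
                      [:: 1; 0; 0; 0; 0; 0; 0; 1; 1];
                      [:: 0; 0; 0; 1; 0; 1; 0; 1; 0];
                      [:: 0; 0; 1; 0; 0; 0; 1; 1; 0];
                      [:: 1; 0; 0; 0; 1; 1; 1; 0; 0];
                      [:: 0; 0; 0; 1; 1; 0; 0; 0; 1]]%N.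

Definition ord9 : seq 'I_9 := [:: @Ordinal 9 0 isT; @Ordinal 9 1 isT;
  @Ordinal 9 2 isT; @Ordinal 9 3 isT; @Ordinal 9 4 isT; @Ordinal 9 5 isT;
  @Ordinal 9 6 isT; @Ordinal 9 7 isT; @Ordinal 9 8 isT].


(** * Minors indexed by lists *)

Section ListMinors.
Variables (K : comNzRingType) (n : nat) (H : 'I_n.+1 -> 'I_n.+1 -> K).
Implicit Types s t : seq 'I_n.+1.

(** With lists, bordering a minor is concatenation, and the order of the columns can place the
    optimal assignment on the diagonal. *)
Definition minormx m q s t : 'M[K]_(m, q) :=
  \matrix_(i, j) H (nth ord0 s i) (nth ord0 t j).

Lemma minormx_cat m q s0 s1 t0 t1 : size s0 = m -> size t0 = m ->
  minormx (m + q) (m + q) (s0 ++ s1) (t0 ++ t1) =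
  block_mx (minormx m m s0 t0) (minormx m q s0 t1)
           (minormx q m s1 t0) (minormx q q s1 t1).
Proof.
move=> ss st; have nthE s s' (i : 'I_(m + q)) : size s = m ->
    nth ord0 (s ++ s') i =
    match fintype.split i with inl k => nth ord0 s k | inr k => nth ord0 s' k end.
  move=> sz; rewrite nth_cat sz /fintype.split.
  by case: ltnP.
apply/matrixP => i j; rewrite [LHS]mxE !nthE // -[in RHS](splitK i) -[in RHS](splitK j).
case: (fintype.split i) => i'; case: (fintype.split j) => j' /=.
- by rewrite block_mxEul mxE.
- by rewrite block_mxEur mxE.
- by rewrite block_mxEdl mxE.
- by rewrite block_mxEdr mxE.
Qed.

Lemma minormx_border m s t i j : size s = m -> size t = m ->
  minormx (m + 1) (m + 1) (s ++ [:: i]) (t ++ [:: j]) =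
  block_mx (minormx m m s t) (\col_k H (nth ord0 s k) j)
           (\row_k H i (nth ord0 t k)) (H i j)%:M.
Proof.
move=> ss st; rewrite minormx_cat //; congr block_mx; apply/matrixP => k l;
  by rewrite !mxE ?(ord1 k) ?(ord1 l) ?eqxx ?mulr1n.
Qed.

Lemma sylvester m s t i i' j j' : size s = m -> size t = m ->
  GRing.lreg (\det (minormx m m s t)) ->
  \det (minormx (m + 2) (m + 2) (s ++ [:: i; i']) (t ++ [:: j; j'])) = 0 ->
  let T k l := \det (minormx (m + 1) (m + 1) (s ++ [:: k]) (t ++ [:: l])) in
  T i j * T i' j' = T i j' * T i' j.
Proof.
move=> ss st regP M0 T; move: M0; rewrite minormx_cat // => M0.
have hT := bordered_minors_rank1 regP M0; cbv zeta in hT.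
have TE k l : \det (block_mx (minormx m m s t) (col l (minormx m 2 s [:: j; j']))
    (row k (minormx 2 m [:: i; i'] t)) (minormx 2 2 [:: i; i'] [:: j; j'] k l)%:M) =
    T (nth ord0 [:: i; i'] k) (nth ord0 [:: j; j'] l).
  rewrite /T minormx_border //; congr (\det _); congr block_mx;
  by apply/matrixP => x y; rewrite !mxE.
by rewrite !TE in hT.
Qed.

End ListMinors.

(** * The gap for (6, 5), and the algebra of the second example *)

Section Examples.
Variable R : realType.

(** A repeated index gives two equal rows or columns, so the determinant vanishes for noninjective
    choices as well. *)
Lemma det_rank m r (H : 'I_m -> 'I_m -> hahn R) (f g : 'I_r -> 'I_m) :
  rank_le_pred r (fun i j => hval (H i j)) ->
  \det (\matrix_(i, j) H (f i) (g j)) = 0.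
Proof.
move=> /rank_hahn rk; have [injf|[k [l [_ _ kl e]]]] := noninjectiveP f [set: 'I_r].
  have [injg|[k [l [_ _ kl e]]]] := noninjectiveP g [set: 'I_r].
    by apply: rk => i j; [apply: injf | apply: injg]; rewrite inE.
  rewrite -det_tr; apply: (determinant_alternate kl) => i.
  by rewrite !mxE e.
by apply: (determinant_alternate kl) => i; rewrite !mxE e.
Qed.

Lemma map_nth_ord (T : Type) (x0 : T) m (s : seq T) : size s = m ->
  [seq nth x0 s (val i) | i <- enum 'I_m] = s.
Proof.
move=> <-; rewrite (map_comp (nth x0 s) val) val_enum_ord.
exact: mkseq_nth.
Qed.

Lemma hdeg_minormx n m (a : 'I_n.+1 -> 'I_n.+1 -> nat)
    (H : 'I_n.+1 -> 'I_n.+1 -> hahn R) s t v :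
  (forall i j, hdeg_is (hval (H i j)) (a i j)%:R) ->
  size s = m -> size t = m -> uniq t -> uniq_min a s t v ->
  hdeg_is (hval (\det (minormx H m m s t))) v%:R.
Proof.
move=> degH ss st ut um; apply: (hdeg_det_check degH).
  move=> i j /eqP; rewrite nth_uniq ?st // => /eqP; exact: val_inj.
by rewrite !map_nth_ord.
Qed.

Lemma gap65 : gap R 6 5.
Proof.
pose A : 'M[R]_6 := \matrix_(i, j) (entry shitov6 i j)%:R.
exists A; split.
- apply/matrixP => i j; rewrite !mxE; congr (_%:R).
  by case: i => -[|[|[|[|[|[|]]]]]] // ?; case: j => -[|[|[|[|[|[|]]]]]].
(* Fuel 10 covers the costs 0 to 9, enough to reach every minimum. *)
- apply: (@singular_check _ _ _ ord6 10).
    by apply: (inj_map val_inj); rewrite val_enum_ord.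
  by [].
move=> [L [liftL rkL]]; have [H LE [symH degH]] := sym_lift_hahn liftL.
rewrite LE in rkL.
have degH' i j : hdeg_is (hval (H i j)) (entry shitov6 i j)%:R.
  by have := degH i j; rewrite mxE.
pose o k := nth ord0 ord6 k.
(* One row and one column from each zero block, ordered so that the diagonal is 0; the other entries
   are 4, so this minor has degree 0. *)
pose s0 := [:: o 0; o 2; o 4]%N; pose t0 := [:: o 0; o 4; o 2]%N.
pose T k l := \det (minormx H (3 + 1) (3 + 1) (s0 ++ [:: o k]) (t0 ++ [:: o l])).
have degT k l v : uniq (t0 ++ [:: o l]) ->
    uniq_min (entry shitov6) (s0 ++ [:: o k]) (t0 ++ [:: o l]) v ->
    hdeg_is (hval (T k l)) v%:R.
  exact: hdeg_minormx.
have regP : GRing.lreg (\det (minormx H 3 3 s0 t0)).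
  by apply: (@hdeg_lreg _ _ 0%:R); apply: hdeg_minormx degH' _ _ _ _.
(* Rows 1, 3, 5 and columns 1, 5, 3 are the indices 1, 2, 3 of the overview. [T 3 5] is thus the
   diagonal term T22, where the tropical minimum is tied; it is eliminated between [e1] and [e2]. *)
have e1 : T 1%N 5%N * T 3%N 3%N = T 1%N 3%N * T 3%N 5%N.
  by apply: sylvester => //; apply: det_rank.
have e2 : T 3%N 5%N * T 5%N 1%N = T 3%N 1%N * T 5%N 5%N.
  by apply: sylvester => //; apply: det_rank.
have e : T 1%N 5%N * T 3%N 3%N * T 5%N 1%N = T 1%N 3%N * (T 3%N 1%N * T 5%N 5%N).
  by rewrite e1 -e2 mulrA.
(* Each degree is the corresponding entry of [shitov6]; the entry 3 at (5, 5) makes the two sums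
   differ. *)
have d1 : hdeg_is (hval (T 1%N 5%N * T 3%N 3%N * T 5%N 1%N)) (2%:R + 2%:R + 2%:R).
  by do !apply: hdegM; apply: degT.
have d2 : hdeg_is (hval (T 1%N 3%N * (T 3%N 1%N * T 5%N 5%N))) (2%:R + (2%:R + 3%:R)).
  by do !apply: hdegM; apply: degT.
by move: d1; rewrite e => /(hdeg_inj d2); lra.
Qed.

(** Here a_kl are residues, c, s, u are ratios of row 0 or row 1 to row 2, and (X, 1, Z) are the
    coordinates of rows 4, 6, 7 in rows 0, 1, 2. Elimination gives Z4 = -s, Z7 = -u, u = 2s and Z4 +
    Z7 = 0, whence 3s = 0. *)
Lemma pg9_char3 (F : fieldType)
  (a00 a02 a05 a06 a08 a14 a15 a16 a17 a18 a22 a24 a25 a27 a28 c s u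
   X4 Z4 X6 Z6 X7 Z7 : F) :
  a02 != 0 -> a06 != 0 -> a17 != 0 -> a22 != 0 -> a24 != 0 -> a25 != 0 ->
  a27 != 0 -> a28 != 0 ->
  a02 = c * a22 -> a05 = c * a25 -> a08 = c * a28 ->
  a15 = s * a25 -> a17 = s * a27 -> a14 = u * a24 -> a18 = u * a28 ->
  X4 * a00 + Z4 * a02 = 0 -> a17 + Z4 * a27 = 0 ->
  X4 * a08 + a18 + Z4 * a28 = 0 ->
  X6 * a02 + Z6 * a22 = 0 -> X6 * a06 + a16 = 0 -> a17 + Z6 * a27 = 0 ->
  X7 * a00 + Z7 * a02 = 0 -> a14 + Z7 * a24 = 0 ->
  X7 * a05 + a15 + Z7 * a25 = 0 -> X7 * a06 + a16 = 0 ->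
  3%:R = 0 :> F.
Proof.
move=> n02 n06 n17 n22 n24 n25 n27 n28 e02 e05 e08 e15 e17 e14 e18
  r40 r47 r48 r62 r66 r67 r70 r74 r75 r76.
have canc x y z : y != 0 -> z = x * y -> z = 0 -> x = 0 :> F.
  by move=> y0 -> /eqP; rewrite mulf_eq0 (negbTE y0) orbF => /eqP.
have n_c : c != 0 by apply: contra_neq n02 => c0; rewrite e02 c0 mul0r.
have n_s : s != 0 by apply: contra_neq n17 => s0; rewrite e17 s0 mul0r.
have z4 : s + Z4 = 0 by apply: (canc _ _ _ n27 _ r47); rewrite e17; ring.
have x4 : X4 * c + u + Z4 = 0.
  by apply: (canc _ _ _ n28 _ r48); rewrite e08 e18; ring.
have z6 : s + Z6 = 0 by apply: (canc _ _ _ n27 _ r67); rewrite e17; ring.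
have x6 : X6 * c + Z6 = 0 by apply: (canc _ _ _ n22 _ r62); rewrite e02; ring.
have z7 : u + Z7 = 0 by apply: (canc _ _ _ n24 _ r74); rewrite e14; ring.
have x7 : X7 * c + s + Z7 = 0.
  by apply: (canc _ _ _ n25 _ r75); rewrite e05 e15; ring.
have x67 : X6 - X7 = 0.
  apply: (canc _ _ (X6 * a06 + a16 - (X7 * a06 + a16)) n06); first by ring.
  by rewrite r66 r76 subrr.
have x47 : X4 + X7 = 0.
  apply: (canc _ _ (X4 * c + u + Z4 - (s + Z4) + (X7 * c + s + Z7) - (u + Z7)) n_c).
    by ring.
  by rewrite x4 z4 x7 z7; ring.
have u2s : u - s *+ 2 = 0.
  have -> : u - s *+ 2 = (u + Z7) - (X7 * c + s + Z7) - (X6 - X7) * c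
      + (X6 * c + Z6) - (s + Z6) by ring.
  by rewrite z7 x7 x67 x6 z6; ring.
have z47 : Z4 + Z7 = 0.
  apply: (canc _ _ (X4 * a00 + Z4 * a02 + (X7 * a00 + Z7 * a02)
    - (X4 + X7) * a00) n02); first by ring.
  by rewrite r40 r70 x47; ring.
apply: (canc _ _ ((s + Z4) + (u + Z7) - (Z4 + Z7) - (u - s *+ 2)) n_s).
  by ring.
by rewrite z4 z7 z47 u2s; ring.
Qed.
End Examples.

(** * The gap for (9, 4) *)

Section ResidueExample.
Variable R : realType.

Lemma gap94 : gap R 9 4.
Proof.
pose A : 'M[R]_9 := \matrix_(i, j) (entry pg9 i j)%:R.
exists A; split.
- apply/matrixP => i j; rewrite !mxE; congr (_%:R).
  by case: i => -[|[|[|[|[|[|[|[|[|]]]]]]]]] // ?;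
     case: j => -[|[|[|[|[|[|[|[|[|]]]]]]]]].
- apply: (@singular_check _ _ _ ord9 3).
    by apply: (inj_map val_inj); rewrite val_enum_ord.
  by vm_compute.
move=> [L [liftL rkL]]; have [H LE [symH degH]] := sym_lift_hahn liftL.
rewrite LE in rkL.
have degH' i j : hdeg_is (hval (H i j)) (entry pg9 i j)%:R.
  by have := degH i j; rewrite mxE.
have geH i j : hge (H i j) 0.
  by apply: hge_le (degH' i j).2; apply: ler0n.
pose M i j := hval (H i j) 0.
pose o k := nth ord0 ord9 k.
have Mz k l : entry pg9 (o k) (o l) != 0%N -> M (o k) (o l) = 0.
  by move=> nz; apply: (degH' _ _).2; rewrite ltr0n lt0n.
have Mnz k l : entry pg9 (o k) (o l) == 0%N -> M (o k) (o l) != 0.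
  by move=> /eqP z; have := (degH' (o k) (o l)).1; rewrite z.
have residue m s t : hval (\det (minormx H m m s t)) 0 = \det (minormx M m m s t).
  rewrite det_residue => [|i j]; last by rewrite mxE.
  by congr (\det _); apply/matrixP => i j; rewrite !mxE.
(* Column 3 replaces column 0, with which the minimum would be tied; here the diagonal is the only
   assignment of cost 0. *)
pose s0 := [:: o 0; o 1; o 2]%N; pose t0 := [:: o 3; o 1; o 2]%N.
set dP := \det (minormx M 3 3 s0 t0).
have dP0 : dP != 0.
  have [] : hdeg_is (hval (\det (minormx H 3 3 s0 t0))) 0%:R.
    exact: hdeg_minormx degH' _ _ _ _.
  by rewrite residue.
have regP : GRing.lreg dP by apply: mulfI.
(* Rows 0, 1, 2 span all rows of [M]: the 4-minor bordering [dP] by row [i] and column [l] vanishes,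
   and expanding it gives coefficients independent of [l]. *)
have span i : exists x y z, forall l, M i (o l) =
    x * M (o 0%N) (o l) + y * M (o 1%N) (o l) + z * M (o 2%N) (o l).
  pose w := (\row_k M i (nth ord0 t0 k)) *m \adj (minormx M 3 3 s0 t0).
  exists (w 0 0 / dP), (w 0 1 / dP), (w 0 (1 + 1) / dP) => l.
  have : \det (minormx M (3 + 1) (3 + 1) (s0 ++ [:: i]) (t0 ++ [:: o l])) = 0.
    by rewrite -residue det_rank.
  rewrite minormx_border // det_bordered //.
  rewrite -/w -/dP mxE !big_ord_recl big_ord0 !mxE /= addr0 => /eqP.
  rewrite subr_eq0 => /eqP e; apply: (mulfI dP0); rewrite e.
  have -> : lift ord0 (ord0 : 'I_2) = 1 :> 'I_3 by apply/val_inj.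
  have -> : lift ord0 (lift ord0 (ord0 : 'I_1)) = 1 + 1 :> 'I_3 by apply/val_inj.
  by field.
have z01 := Mz 0%N 1%N isT; have z04 := Mz 0%N 4%N isT.
have z07 := Mz 0%N 7%N isT; have z10 := Mz 1%N 0%N isT.
have z12 := Mz 1%N 2%N isT; have z13 := Mz 1%N 3%N isT.
have z21 := Mz 2%N 1%N isT; have z23 := Mz 2%N 3%N isT.
have z26 := Mz 2%N 6%N isT.
have n11 := Mnz 1%N 1%N isT.
(* In column 1, rows 0 and 2 vanish, so a row that is nonzero there involves row 1 and can be scaled
   to have coefficient 1 on it. *)
have span1 k : entry pg9 (o k) (o 1%N) == 0%N -> exists x z, forall l,
    M (o k) (o l) = 0 ->
    x * M (o 0%N) (o l) + M (o 1%N) (o l) + z * M (o 2%N) (o l) = 0.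
  move=> /Mnz nk1; have [x [y [z e]]] := span (o k).
  have y0 : y != 0.
    by apply: contra_neq nk1 => y0; rewrite e y0 z01 z21; ring.
  exists (x / y), (z / y) => l; rewrite e => el; apply: (mulfI y0).
  by rewrite mulr0 -el; field.
(* Row 3 vanishes in column 1, so it combines rows 0 and 2 only; each zero of row 3 then makes row 0
   a fixed multiple of row 2 in that column. *)
have [x3 [y3 [z3 e3]]] := span (o 3%N).
have y30 : y3 = 0.
  have := Mz 3%N 1%N isT; rewrite e3 z01 z21 !mulr0 add0r addr0 => /eqP.
  by rewrite mulf_eq0 (negbTE n11) orbF => /eqP.
have x30 : x3 != 0.
  have := Mnz 3%N 0%N isT; apply: contra_neq => x30; rewrite e3 x30 y30.
  have := Mz 3%N 2%N isT; rewrite e3 x30 y30 !mul0r !add0r => /eqP.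
  by rewrite mulf_eq0 (negbTE (Mnz 2%N 2%N isT)) orbF => /eqP ->; ring.
have row3 l : M (o 3%N) (o l) = 0 -> M (o 0%N) (o l) = - z3 / x3 * M (o 2%N) (o l).
  rewrite e3 y30 => e; apply: (mulfI x30).
  transitivity (- (z3 * M (o 2%N) (o l))); last by field.
  by apply/eqP; rewrite -subr_eq0 opprK -e; apply/eqP; ring.
have [x5 [z5 e5]] := span1 5%N isT; have [x8 [z8 e8]] := span1 8%N isT.
(* In column 3, rows 1 and 2 vanish but row 0 does not; rows 5 and 8 vanish there too, so they
   combine rows 1 and 2 only. *)
have x50 : x5 = 0.
  have := e5 3%N (Mz 5%N 3%N isT); rewrite z13 z23 mulr0 !addr0 => /eqP.
  by rewrite mulf_eq0 (negbTE (Mnz 0%N 3%N isT)) orbF => /eqP.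
have x80 : x8 = 0.
  have := e8 3%N (Mz 8%N 3%N isT); rewrite z13 z23 mulr0 !addr0 => /eqP.
  by rewrite mulf_eq0 (negbTE (Mnz 0%N 3%N isT)) orbF => /eqP.
have row5 l : M (o 5%N) (o l) = 0 -> M (o 1%N) (o l) = - z5 * M (o 2%N) (o l).
  by move=> /e5; rewrite x50 mul0r add0r => /eqP; rewrite addr_eq0 mulNr => /eqP.
have row8 l : M (o 8%N) (o l) = 0 -> M (o 1%N) (o l) = - z8 * M (o 2%N) (o l).
  by move=> /e8; rewrite x80 mul0r add0r => /eqP; rewrite addr_eq0 mulNr => /eqP.
have [x4 [z4 e4]] := span1 4%N isT; have [x6 [z6 e6]] := span1 6%N isT.
have [x7 [z7 e7]] := span1 7%N isT.
(* The symmetry of the lift enters here, linking column 0 of row 2 to column 2 of row 0. *)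
have M20 : M (o 2%N) (o 0%N) = M (o 0%N) (o 2%N) by rewrite /M symH.
have r40 := e4 0%N (Mz 4%N 0%N isT); rewrite z10 addr0 M20 in r40.
have r47 := e4 7%N (Mz 4%N 7%N isT); rewrite z07 mulr0 add0r in r47.
have r48 := e4 8%N (Mz 4%N 8%N isT).
have r62 := e6 2%N (Mz 6%N 2%N isT); rewrite z12 addr0 in r62.
have r66 := e6 6%N (Mz 6%N 6%N isT); rewrite z26 mulr0 addr0 in r66.
have r67 := e6 7%N (Mz 6%N 7%N isT); rewrite z07 mulr0 add0r in r67.
have r70 := e7 0%N (Mz 7%N 0%N isT); rewrite z10 addr0 M20 in r70.
have r74 := e7 4%N (Mz 7%N 4%N isT); rewrite z04 mulr0 add0r in r74.
have r75 := e7 5%N (Mz 7%N 5%N isT).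
have r76 := e7 6%N (Mz 7%N 6%N isT); rewrite z26 mulr0 addr0 in r76.
have := pg9_char3 (Mnz 0 2 isT)%N (Mnz 0 6 isT)%N (Mnz 1 7 isT)%N
  (Mnz 2 2 isT)%N (Mnz 2 4 isT)%N (Mnz 2 5 isT)%N (Mnz 2 7 isT)%N
  (Mnz 2 8 isT)%N
  (row3 2 (Mz 3 2 isT))%N (row3 5 (Mz 3 5 isT))%N (row3 8 (Mz 3 8 isT))%N
  (row5 5 (Mz 5 5 isT))%N (row5 7 (Mz 5 7 isT))%N
  (row8 4 (Mz 8 4 isT))%N (row8 8 (Mz 8 8 isT))%N
  r40 r47 r48 r62 r66 r67 r70 r74 r75 r76.
by move/eqP; rewrite pnatr_eq0.
Qed.

End ResidueExample.

Theorem theorem7 (R : realType) (n r : nat) :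
  ((4 < r)%N /\ (r < n)%N) \/ (r = 4%N /\ (12 < n)%N) ->
  ~ minors_tropical_basis R n r.
Proof.
move=> h; apply: gap_not_basis; case: h => [[r4 rn]|[-> n12]]; last first.
  by apply: (@gap_blowup _ 9) (gap94 R) => //; apply: leq_trans n12.
(* Bordering [k] = r - 5 times gives a gap for (r + 1, r); repeating indices then reaches every
   larger n. *)
have gapS k : gap R (6 + k) (5 + k).
  by elim: k => [|k IHk]; [exact: gap65 | rewrite !addnS; apply: gap_border].
apply: (@gap_blowup _ r.+1) => //; first by apply: leq_trans r4.
by have := gapS (r - 5)%N; rewrite addSn subnKC.
Qed.
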